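(* Let $D$ be a finite directed multigraph and let $p$ be a pebble distribution on $V(D)$. Then $D$ is orderable under $p$ if and only if both of the following hold: (1) (balance condition) every vertex $v$ of $D$ satisfies $\mathrm{balance}(D,p,v)\ge 0$; and (2) (sink condition) every nontrivial sink $A$ in $\mathrm{comp}(D)$ contains some vertex $v$ with $\mathrm{balance}(D,p,v)\ge 1$.
   Context: Directed multigraphs may have multiple edges and loops. A pebble distribution on a vertex set $V$ is a function $p:V\to\{0,1,2,\dots\}$. A pebbling move $uv$ (along an edge from $u$ to $v$) is allowed when $u$ currently has at least two pebbles; it removes two pebbles from $u$ and adds one pebble to $v$. A directed multigraph $D$ is orderable under $p$ if some ordering of the edges of $D$ (counted with multiplicity) is a valid sequence of pebbling moves starting from $p$. Writing $\mathrm{indeg}_D(v)$ and $\mathrm{outdeg}_D(v)$ for the indegree and outdegree of $v$ in $D$ counted with multiplicity, $\mathrm{balance}(D,p,v)=p(v)+\mathrm{indeg}_D(v)-2\,\mathrm{outdeg}_D(v)$. The component digraph $\mathrm{comp}(D)$ is obtained by contracting each strongly connected component of $D$ to a single vertex; a sink of $\mathrm{comp}(D)$ is thus a strongly connected component of $D$ with no edge of $D$ leaving it to another component. A strongly connected component is trivial if it consists of a single vertex with indegree and outdegree zero, and nontrivial otherwise. *)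

(* Defs.v *)
From HB Require Import structures.
From mathcomp Require Import all_boot all_order all_algebra.

Set Implicit Arguments.
Unset Strict Implicit.
Unset Printing Implicit Defensive.

(* Edges form a type of their own, so multiple edges and loops are allowed and
   every count over [edge D] is a count with multiplicity. *)
Record mdigraph := MDigraph {
  vertex :> finType;
  edge : finType;
  src : edge -> vertex;
  tgt : edge -> vertex
}.

Definition indeg (D : mdigraph) (v : D) : nat := #|[set e : edge D | tgt e == v]|.

Definition outdeg (D : mdigraph) (v : D) : nat := #|[set e : edge D | src e == v]|.

Section Pebbling.

Variable D : mdigraph.
Implicit Types (p : D -> nat) (u v : D) (s : seq (edge D)).

Definition can_move p u : bool := 2 <= p u.

Definition move p u v : D -> nat := fun w => p w - 2 * (w == u) + (w == v).

Fixpoint valid p s : bool :=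
  if s is e :: s' then
    can_move p (src e) && valid (move p (src e) (tgt e)) s'
  else true.

Definition orderable p : Prop :=
  exists2 s, perm_eq s (enum (edge D)) & valid p s.

(* Integer-valued: subtraction on [nat] would truncate negative balances. *)
Definition balance p v : int :=
  ((p v)%:Z + (indeg v)%:Z - 2 * (outdeg v)%:Z)%R.

End Pebbling.

Section Components.

Variable D : mdigraph.
Implicit Types (u v : D) (A : {set D}).

Definition adj : rel D :=
  fun u v => [exists e : edge D, (src e == u) && (tgt e == v)].

Definition scc v : {set D} := [set w | connect adj v w && connect adj w v].

Definition sccs : {set {set D}} := [set scc v | v : D].

Lemma scc_in_sccs v : scc v \in sccs.
Proof. exact: imset_f. Qed.

Definition component : finType := {A : {set D} | A \in sccs}.

Definition contract v : component :=
  exist (fun A => A \in sccs) (scc v) (scc_in_sccs v).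

(* Contraction discards the edges inside a component, so [comp_digraph] has no
   loops. *)
Definition comp_digraph : mdigraph :=
  @MDigraph component {e : edge D | contract (src e) != contract (tgt e)}
    (fun e => contract (src (val e))) (fun e => contract (tgt (val e))).

(* Degrees are those of [D], not of [comp_digraph]: a lone vertex carrying a loop is a
   nontrivial component. *)
Definition trivial_scc A : bool :=
  [exists v, [&& A == [set v], indeg v == 0 & outdeg v == 0]].

End Components.

Definition sink (D : mdigraph) (v : D) : bool := outdeg v == 0.

(* Main.v *)
(* Necessity: the balance of a vertex is the number of pebbles it holds once all edges have
   been used, and the head of the last edge entering a sink component keeps the pebble it
   receives.

   Sufficiency: a move preserves all balances, taken with respect to the unused edges.  By
   the sink condition every vertex of positive outdegree reaches a vertex of positive
   balance.  Let [d] be the distance to such vertices and always prefer the legal edge whose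
   head has the largest [d]; then a vertex of balance 0 that still has unused out-edges has
   one that decreases [d].  If no legal move is left, every tail [u] of an unused edge holds
   at most one pebble, so nonnegative balance gives [outdeg u <= 2 outdeg u - 1 <= indeg u];
   summing over all vertices, [indeg = outdeg] everywhere.  Hence every such tail has
   balance 0 and every head of an unused edge is again a tail, so [d] could be decreased
   forever. *)
Require Import Defs.
From mathcomp Require Import all_boot all_order all_algebra.
From mathcomp Require Import zify.

Set Implicit Arguments.
Unset Strict Implicit.
Unset Printing Implicit Defensive.

(** * Pebbling along a sequence of edges *)

Section Sequences.

Variable D : mdigraph.
Implicit Types (p b d : D -> nat) (u v : D) (e f : edge D) (s : seq (edge D)).

Definition seq_indeg s v : nat := count (fun e => tgt e == v) s.
Definition seq_outdeg s v : nat := count (fun e => src e == v) s.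

Lemma seq_indeg_cons e s v : seq_indeg (e :: s) v = (tgt e == v) + seq_indeg s v.
Proof. by []. Qed.

Lemma seq_outdeg_cons e s v : seq_outdeg (e :: s) v = (src e == v) + seq_outdeg s v.
Proof. by []. Qed.

Arguments seq_indeg : simpl never.
Arguments seq_outdeg : simpl never.

Lemma seq_indeg_enum v : seq_indeg (enum (edge D)) v = indeg v.
Proof. by rewrite /seq_indeg -size_filter /indeg cardsE cardE /enum_mem filter_predT. Qed.

Lemma seq_outdeg_enum v : seq_outdeg (enum (edge D)) v = outdeg v.
Proof. by rewrite /seq_outdeg -size_filter /outdeg cardsE cardE /enum_mem filter_predT. Qed.

Lemma sum_count_eq (g : edge D -> D) s : \sum_v count (fun e => g e == v) s = size s.
Proof.
elim: s => [|e s IHs] /=; first by rewrite big1.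
by rewrite big_split /= IHs (bigD1 (g e)) //= eqxx big1 // => v /negPf; rewrite eq_sym => ->.
Qed.

Lemma move_balance p e v : can_move p (src e) ->
  move p (src e) (tgt e) v + 2 * (src e == v) = p v + (tgt e == v).
Proof.
rewrite /can_move /move (eq_sym (src e)) (eq_sym (tgt e)).
by case: (eqVneq v (src e)) => [->|_]; case: (_ == tgt e) => /=; lia.
Qed.

Lemma valid_balance p s v : valid p s -> 2 * seq_outdeg s v <= p v + seq_indeg s v.
Proof.
elim: s p => [|e s IHs] p //= /andP[/(@move_balance _ _ v) + /IHs].
rewrite seq_outdeg_cons seq_indeg_cons.
by case: (src e == v); case: (tgt e == v); lia.
Qed.

(** Consider the last edge of [s] with head in [A]. A later edge leaving that head would again have
    its head in [A], so the pebble just delivered is never spent. *)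
Lemma valid_closed p s (A : {set D}) :
  (forall e, src e \in A -> tgt e \in A) -> valid p s -> has (fun e => tgt e \in A) s ->
  exists2 v, v \in A & 2 * seq_outdeg s v < p v + seq_indeg s v.
Proof.
move=> clA; elim: s p => [|e s IHs] p //= /andP[hc hv].
have hm v := @move_balance p e v hc.
case: (boolP (has _ s)) => [hs _|hs].
  have [v vA] := IHs _ hv hs; exists v => //; move: (hm v).
  by rewrite seq_outdeg_cons seq_indeg_cons; case: (src e == v); case: (tgt e == v); lia.
rewrite orbF => eA; exists (tgt e) => //.
have out0 : seq_outdeg s (tgt e) = 0.
  apply/eqP; rewrite -leqn0 leqNgt -has_count; apply: contra hs.
  by apply: sub_has => f /= /eqP fe; apply: clA; rewrite fe.
move: (hm (tgt e)); rewrite /move seq_outdeg_cons seq_indeg_cons out0 !eqxx.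
by case: (src e == tgt e); lia.
Qed.

Definition descends b d s := forall e, e \in s -> b (src e) = 0 ->
  exists2 f, f \in s & src f = src e /\ d (tgt f) < d (src e).

Lemma legal_edge b d p s :
  (forall v, p v + seq_indeg s v = b v + 2 * seq_outdeg s v) ->
  descends b d s -> s != [::] -> exists2 e, e \in s & can_move p (src e).
Proof.
move=> hb hd s_neq0; apply/hasP; apply: contraT => /hasPn stuck.
have outdeg_gt0 e : e \in s -> 0 < seq_outdeg s (src e).
  by move=> es; rewrite -has_count; apply/hasP; exists e.
have out_le_in v : seq_outdeg s v <= seq_indeg s v
                     ?= iff (seq_outdeg s v == seq_indeg s v).
  split=> //; have [->//|] := posnP (seq_outdeg s v).
  move=> out_gt0; move: (out_gt0); rewrite -has_count => /hasP[e es /eqP ev].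
  by move: (stuck e es) (hb v); rewrite ev /can_move; lia.
have in_out v : seq_outdeg s v = seq_indeg s v.
  (* Both sums equal [size s], so every termwise inequality is an equality. *)
  have [_] := leqif_sum (fun v (_ : true) => out_le_in v).
  by rewrite !sum_count_eq eqxx => /esym/forallP/(_ v)/eqP.
have [e0 e0s] : exists e0, e0 \in s.
  by case: (s) s_neq0 => // e0 s' _; exists e0; rewrite mem_head.
case: (@arg_minnP _ e0 (mem s) (fun e => d (src e)) e0s) => e es emin.
(* With equal degrees, [hb] gives [p = b + seq_outdeg s] at [src e], where [p] is at most 1 and the
   outdegree at least 1. *)
have be : b (src e) = 0.
  move: (stuck e es) (hb (src e)) (in_out (src e)) (outdeg_gt0 e es).
  by rewrite /can_move; lia.
have [f fs [_ df]] := hd e es be.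
have : 0 < seq_outdeg s (tgt f) by rewrite in_out -has_count; apply/hasP; exists f.
rewrite -has_count => /hasP[g gs /eqP gf].
by have := emin g gs; rewrite gf leqNgt df.
Qed.

Lemma descends_valid b d p s :
  (forall v, p v + seq_indeg s v = b v + 2 * seq_outdeg s v) ->
  descends b d s -> exists2 s', perm_eq s' s & valid p s'.
Proof.
have [n] := ubnP (size s); elim: n => // n IHn in p s * => sz_s hb hd.
case: (eqVneq s [::]) => [->|s_neq0]; first by exists [::].
have [e0 e0s e0m] := legal_edge hb hd s_neq0.
have e0P : (e0 \in s) && can_move p (src e0) by rewrite e0s.
have [e /andP[es em] emax] := @arg_maxnP _ e0
  (fun e => (e \in s) && can_move p (src e)) (fun e => d (tgt e)) e0P.
have ps := perm_to_rem es.
have [|||s' ps' vs'] := IHn (move p (src e) (tgt e)) (rem e s).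
- by move: (perm_size ps) sz_s => /= ->.
- move=> v; move: (hb v) (@move_balance p e v em).
  rewrite /seq_indeg /seq_outdeg !(permP ps) /=.
  by case: (src e == v); case: (tgt e == v); lia.
- move=> f fs bf.
  have fs' : f \in s := mem_rem fs.
  (* If the witness for [f] was the removed edge [e], then [f] has the same tail, so it was legal
     too, and the maximal choice of [e] makes [f] its own witness. *)
  have [g] := hd f fs' bf; rewrite (perm_mem ps) inE => /predU1P[-> [ef dg]|gs hg]; last first.
    by exists g.
  exists f => //; split=> //; apply: leq_ltn_trans dg; apply: emax.
  by rewrite fs' -ef.
exists (e :: s'); last by rewrite /= em.
by rewrite perm_sym (perm_trans ps) // perm_cons perm_sym.
Qed.

End Sequences.

(** * Distances and sink components *)

Section Reachability.

Variable D : mdigraph.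
Implicit Types (u v w : D) (e : edge D).

Lemma connect_tgt e : connect (@adj D) (src e) (tgt e).
Proof. by apply: connect1; apply/existsP; exists e; rewrite !eqxx. Qed.

Lemma connect_indeg_gt0 u v : connect (@adj D) u v -> u != v -> 0 < indeg v.
Proof.
case/connectP => q; case/lastP: q => [|q x]; first by move=> _ -> /=; rewrite eqxx.
rewrite rcons_path last_rcons => /andP[_ /existsP[e /andP[_ /eqP ex]]] -> _.
by apply/card_gt0P; exists e; rewrite inE ex.
Qed.

Lemma distance_exists (B : pred D) : exists d : D -> nat, forall u v,
  connect (@adj D) u v -> B v -> ~~ B u -> exists2 e, src e = u & d (tgt e) < d u.
Proof.
(* A walk of exactly [n] edges from [u] into [B]; the least such [n] becomes [d u]. *)
pose fix within n u {struct n} :=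
  if n is m.+1 then [exists e : edge D, (src e == u) && within m (tgt e)] else B u.
have reach u v : connect (@adj D) u v -> B v -> exists n, within n u.
  case/connectP => q; elim: q u => [|x q IHq] u /=; first by move=> _ -> Bu; exists 0.
  case/andP=> /existsP[e /andP[eu /eqP ex]] xq lv Bv.
  have [n nx] := IHq x xq lv Bv.
  by exists n.+1; apply/existsP; exists e; rewrite eu ex.
have [d hd] : exists d : D -> nat, forall u n, within n u ->
    within (d u) u /\ d u <= n.
  apply: (fin_all_exists (P := fun u m => forall n, within n u -> within m u /\ m <= n)) => u.
  case: (boolP [exists v, connect (@adj D) u v && B v]) => [/existsP[v /andP[uv Bv]]|nB].
    case: (ex_minnP (reach u v uv Bv)) => m mu mmin.
    by exists m => n nu; split=> //; apply: mmin.
  (* Default value where [B] is out of reach: there [within n u] fails for every [n]. *)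
  exists 0 => n nu; case/negP: nB.
  elim: n u nu => [|n IHn] u /=; first by move=> Bu; apply/existsP; exists u; rewrite connect0.
  case/existsP=> e /andP[/eqP <- /IHn /existsP[v /andP[ev Bv]]].
  by apply/existsP; exists v; rewrite Bv (connect_trans (connect_tgt e)).
exists d => u v uv Bv nBu.
have [n nu] := reach u v uv Bv; have [] := hd u n nu.
case du : (d u) => [|m] /=; first by rewrite (negPf nBu).
case/existsP=> e /andP[/eqP eu me] _; exists e => //.
by have [_] := hd _ _ me.
Qed.

(** An edge leaving [A] would survive contraction as an out-edge of [A] in [comp_digraph D]. *)
Lemma sink_closed (A : comp_digraph D) e :
  sink A -> src e \in sval A -> tgt e \in sval A.
Proof.
case: A => A AP; rewrite /sink => /eqP/eqP; rewrite cards_eq0 => /eqP nA /= eA.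
apply: contraT => teA.
have /imsetP[x _ Ax] := AP.
have sA : scc (src e) = A.
  move: eA; rewrite Ax inE => /andP[xe ex]; apply/setP => y; rewrite !inE.
  by apply/andP/andP=> -[h1 h2]; split; apply: connect_trans; eassumption.
have ne : contract (src e) != contract (tgt e).
  apply: contra teA => /eqP/(congr1 val) /= h.
  by rewrite -sA h inE connect0.
have : (exist _ e ne : edge (comp_digraph D)) \in set0.
  by rewrite -nA inE; apply/eqP/val_inj => /=.
by rewrite inE.
Qed.

(** A second vertex of [A] is entered by a path from the first; an out-edge of a lone vertex stays
    in [A] because [A] is a sink. *)
Lemma nontrivial_has_edge (A : comp_digraph D) :
  sink A -> ~~ trivial_scc (sval A) -> exists e, tgt e \in sval A.
Proof.
move=> sA; have cl e := @sink_closed A e sA.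
case: A sA cl => A /= AP _ cl; have /imsetP[x _ Ax] := AP.
have xA : x \in A by rewrite Ax inE connect0.
have from_indeg v : v \in A -> 0 < indeg v -> exists e, tgt e \in A.
  by move=> vA /card_gt0P[e]; rewrite inE => /eqP ev; exists e; rewrite ev.
move=> /existsPn /(_ x); rewrite !negb_and => /or3P[Ax1|ix|].
- have /existsP[y /andP[yA yx]] : [exists y, (y \in A) && (y != x)].
    apply: contraNT Ax1 => /existsPn h; apply/eqP/setP => y; rewrite inE.
    have := h y; rewrite negb_and negbK => /orP[yA|/eqP->]; last by rewrite xA eqxx.
    by rewrite (negPf yA); apply/esym/negbTE; apply: contraNneq yA => ->.
  apply: (from_indeg y yA); apply: (@connect_indeg_gt0 x); last by rewrite eq_sym.
  by move: yA; rewrite Ax inE => /andP[].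
- by apply: (from_indeg x) => //; rewrite lt0n.
- by rewrite -lt0n => /card_gt0P[e]; rewrite inE => /eqP ex; exists e; apply: cl; rewrite ex.
Qed.

(** Among the vertices reachable from [u], let [w] have the fewest reachable vertices. Whatever [w]
    reaches has the same reachable set, hence reaches [w] back, so the component of [w] is a
    sink. *)
Lemma reaches_nontrivial_sink u : 0 < outdeg u ->
  exists2 A : comp_digraph D, sink A /\ ~~ trivial_scc (sval A)
    & forall v, v \in sval A -> connect (@adj D) u v.
Proof.
move=> ou.
have [w uw wmin] := @arg_minnP _ u (connect (@adj D) u)
  (fun w => #|[set x | connect (@adj D) w x]|) (connect0 _ u).
have back x : connect (@adj D) w x -> connect (@adj D) x w.
  move=> wx; have sub : [set y | connect (@adj D) x y] \subset [set y | connect (@adj D) w y].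
    by apply/subsetP => y; rewrite !inE; apply: connect_trans.
  have /eqP/setP/(_ w) : [set y | connect (@adj D) x y] == [set y | connect (@adj D) w y].
    by rewrite eqEcard sub wmin //; apply: connect_trans wx.
  by rewrite !inE connect0.
exists (contract w); last by move=> v; rewrite inE => /andP[wv _]; apply: connect_trans wv.
split; last first.
  apply/existsPn => v; apply/negP => /and3P[/eqP /= wv iv ov].
  have vw : w = v by apply/set1P; rewrite -wv inE connect0.
  move: iv ov; rewrite -vw => iw ow.
  (* An isolated [w] is neither [u], which has an out-edge, nor the end of a path from another
     vertex. *)
  case: (eqVneq u w) => [uw'|/(connect_indeg_gt0 uw)]; last by rewrite (eqP iw).
  by move: ou; rewrite uw' (eqP ow).
rewrite /sink cards_eq0; apply/eqP/setP => -[e ne]; rewrite !inE /=.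
apply: contraNF ne => /eqP/(congr1 val) /= ew; apply/eqP/val_inj => /=; rewrite ew.
have : src e \in scc w by rewrite -ew inE connect0.
rewrite inE => /andP[we _].
have wt := connect_trans we (connect_tgt e).
have tw := back _ wt.
by apply/setP => x; rewrite !inE; apply/andP/andP => -[h1 h2]; split;
   apply: connect_trans; eassumption.
Qed.

End Reachability.

Theorem theorem2p5 (D : mdigraph) (p : D -> nat) :
  orderable p <->
  (forall v : D, (0 <= balance p v)%R) /\
  (forall A : comp_digraph D, sink A -> ~~ trivial_scc (sval A) ->
     exists2 v : D, v \in sval A & (1 <= balance p v)%R).
Proof.
split=> [[s ps vs]|[bal_ge0 bal_sink]].
  have inE' v : seq_indeg s v = indeg v.
    by rewrite -seq_indeg_enum; apply: (permP ps).
  have outE v : seq_outdeg s v = outdeg v.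
    by rewrite -seq_outdeg_enum; apply: (permP ps).
  split=> [v|A sA ntA].
    by have := @valid_balance D p s v vs; rewrite inE' outE /balance; lia.
  have [e eA] := nontrivial_has_edge sA ntA.
  have [||v vA] := @valid_closed D p s (sval A) _ vs.
  - by move=> f; apply: sink_closed.
  - by apply/hasP; exists e; rewrite // (perm_mem ps) mem_enum.
  by rewrite inE' outE => hv; exists v => //; rewrite /balance; lia.
(* By [bal_ge0] this truncated subtraction is exact, so [b] is the balance as a natural number. *)
pose b v := p v + indeg v - 2 * outdeg v.
have [d hd] := @distance_exists D (fun v => 0 < b v).
apply: (@descends_valid D b d) => [v|e _ be].
  by rewrite seq_indeg_enum seq_outdeg_enum /b; move: (bal_ge0 v); rewrite /balance; lia.
have [|A [sA ntA] uA] := @reaches_nontrivial_sink D (src e).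
  by apply/card_gt0P; exists e; rewrite inE.
have [v vA bv] := bal_sink A sA ntA.
have [||f fe df] := hd (src e) v (uA v vA).
- by move: bv; rewrite /b /balance; lia.
- by rewrite be.
by exists f; rewrite ?mem_enum.
Qed.
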